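(* All three of the following hold. (i) For every $n\ge 3$ there exist $m\ge1$, type spaces $\mathcal{T}^1,\dots,\mathcal{T}^n$ in $\mathbb{R}^m$ with $r_1,\dots,r_n$ entries respectively, and $g\in\mathrm{IC}(\mathcal{T}^1,\dots,\mathcal{T}^n)$, such that there do not exist type spaces $\mathcal{S}^1,\dots,\mathcal{S}^n$ in $\mathbb{R}^m$ with $r_1,\dots,r_n$ entries respectively satisfying both $g\in\mathrm{AM}(\mathcal{S}^1,\dots,\mathcal{S}^n)$ and $\mathrm{IC}(\mathcal{S}^1)=\mathrm{IC}(\mathcal{T}^1)$. (ii) For every $n\ge 2$ there exist $m\ge1$, type spaces $\mathcal{T}^1,\dots,\mathcal{T}^n$ in $\mathbb{R}^m$ with $r_1,\dots,r_n$ entries respectively, and $g\in\mathrm{IC}(\mathcal{T}^1,\dots,\mathcal{T}^n)$, such that there do not exist type spaces $\mathcal{S}^1,\dots,\mathcal{S}^n$ in $\mathbb{R}^m$ with $r_1,\dots,r_n$ entries respectively satisfying both $g\in\mathrm{AM}(\mathcal{S}^1,\dots,\mathcal{S}^n)$ and $\mathrm{IC}(\mathcal{S}^1,\dots,\mathcal{S}^n)=\mathrm{IC}(\mathcal{T}^1,\dots,\mathcal{T}^n)$. (iii) For every $n\ge 2$ there exist $m\ge1$, type spaces $\mathcal{T}^1,\dots,\mathcal{T}^n$ in $\mathbb{R}^m$ with $r_1,\dots,r_n$ entries respectively, and a pair $g,h\in\mathrm{IC}(\mathcal{T}^1,\dots,\mathcal{T}^n)$, such that there do not exist type spaces $\mathcal{S}^1,\dots,\mathcal{S}^n$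 in $\mathbb{R}^m$ with $r_1,\dots,r_n$ entries respectively satisfying $g\in\mathrm{AM}(\mathcal{S}^1,\dots,\mathcal{S}^n)$, $h\in\mathrm{AM}(\mathcal{S}^1,\dots,\mathcal{S}^n)$ and $\mathrm{IC}(\mathcal{S}^1)=\mathrm{IC}(\mathcal{T}^1)$.
   Context: Write $[m]=\{1,\dots,m\}$. A (single-player) type space with $r$ entries is an ordered tuple $\mathcal{T}=(\mathcal{T}_1,\dots,\mathcal{T}_r)$ of vectors in $\mathbb{R}^m$; its type matrix $T\in\mathbb{R}^{r\times m}$ has these vectors as rows, in the same order. Let $\mathcal{T}^1,\dots,\mathcal{T}^n$ be type spaces in $\mathbb{R}^m$ with $r_1,\dots,r_n$ entries and type matrices $T^1,\dots,T^n$. An outcome function $g$ on $\mathcal{T}^1\times\cdots\times\mathcal{T}^n$ is identified with a tensor $g\in[m]^{r_1\times\cdots\times r_n}$, i.e. a function $[r_1]\times\cdots\times[r_n]\to[m]$, $g(i_1,\dots,i_n)$ being the outcome when player $j$ declares the $i_j$-th entry of $\mathcal{T}^j$. Incentive compatibility: $g$ is IC on $\mathcal{T}^1\times\cdots\times\mathcal{T}^n$ if there is a payment function $p:[r_1]\times\cdots\times[r_n]\to\mathbb{R}^n$ such that for every player $j\in[n]$, every $(i_1,\dots,i_n)$, and every $l\in[r_j]$, $$T^j_{i_j,\,g(i_1,\dots,i_n)}-p(i_1,\dots,i_n)_j\ \ge\ T^j_{i_j,\,g(i_1,\dots,i_{j-1},l,i_{j+1},\dots,i_n)}-p(i_1,\dots,i_{j-1},l,i_{j+1},\dots,i_n)_j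 .$$ $\mathrm{IC}(\mathcal{T}^1,\dots,\mathcal{T}^n)\subseteq[m]^{r_1\times\cdots\times r_n}$ denotes the set of all IC outcome functions; the case $n=1$ defines $\mathrm{IC}(\mathcal{T})\subseteq[m]^r$ for a single type space. Affine maximizers: for $\alpha_1,\dots,\alpha_n>0$ and $\gamma\in\mathbb{R}^m$, let $M(\alpha_1\mathcal{T}^1,\dots,\alpha_n\mathcal{T}^n,\gamma)$ be the single-player type space with $\prod_j r_j$ entries, indexed lexicographically by $(i_1,\dots,i_n)$, whose $(i_1,\dots,i_n)$-th entry is $\alpha_1\mathcal{T}^1_{i_1}+\cdots+\alpha_n\mathcal{T}^n_{i_n}+\gamma$. The outcome function $g$ is an affine maximizer on $\mathcal{T}^1\times\cdots\times\mathcal{T}^n$ if there exist $\alpha_1,\dots,\alpha_n>0$ and $\gamma\in\mathbb{R}^m$ such that $g$, viewed as a vector indexed by the tuples $(i_1,\dots,i_n)$, belongs to the single-player set $\mathrm{IC}(M(\alpha_1\mathcal{T}^1,\dots,\alpha_n\mathcal{T}^n,\gamma))$. The set of all affine maximizers is $\mathrm{AM}(\mathcal{T}^1,\dots,\mathcal{T}^n)$. *)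

(* Defs.v *)
From mathcomp Require Import all_boot all_order all_algebra.
From mathcomp Require Import classical_sets reals.

Set Implicit Arguments.
Unset Strict Implicit.
Unset Printing Implicit Defensive.

Import Order.TTheory GRing.Theory Num.Theory.
Local Open Scope ring_scope.
Local Open Scope classical_set_scope.

(* The entries are indexed by a finite type [I] rather than only by ['I_r], so
   that the mixture below can be indexed directly by the tuples (i_1,...,i_n).
   Repeated entries are allowed. *)
Definition type_space (R : realType) (m : nat) (I : finType) : Type :=
  I -> 'rV[R]_m.

Notation profile r := {dffun forall j, 'I_(r j)}.

(* [i] with its [j]-th component replaced by [l]. *)
Definition deviate (n : nat) (r : 'I_n -> nat)
    (i : profile r) (j : 'I_n) (l : 'I_(r j)) : profile r :=
  [ffun k => dfwith i l k].

Definition IC (R : realType) (m n : nat) (r : 'I_n -> nat)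
    (T : forall j, type_space R m 'I_(r j)) : set {ffun profile r -> 'I_m} :=
  [set g | exists p : profile r -> 'rV[R]_n,
     forall (j : 'I_n) (i : profile r) (l : 'I_(r j)),
       T j (i j) ord0 (g i) - p i ord0 j >=
       T j (i j) ord0 (g (deviate i l)) - p (deviate i l) ord0 j].

Definition IC1 (R : realType) (m : nat) (I : finType)
    (T : type_space R m I) : set {ffun I -> 'I_m} :=
  [set g | exists p : I -> R,
     forall i l : I, T i ord0 (g i) - p i >= T i ord0 (g l) - p l].

(* [IC1] is the one-player case of [IC]. *)
Lemma IC1_IC (R : realType) (m r : nat) (T : type_space R m 'I_r)
    (g : {ffun 'I_r -> 'I_m}) :
  IC1 T g <->
  IC (fun _ : 'I_1 => T) [ffun i : profile (fun _ : 'I_1 => r) => g (i ord0)].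
Proof.
split=> [[p hp]|[p hp]].
  exists (fun i => const_mx (p (i ord0))) => j i l.
  by rewrite (ord1 j) in l *; rewrite !mxE !ffunE dfwith_in; apply: hp.
pose c (i : 'I_r) : profile (fun _ : 'I_1 => r) := [ffun=> i].
have cE i l : deviate (c i) (j := ord0) l = c l.
  by apply/ffunP => k; rewrite (ord1 k) !ffunE dfwith_in.
exists (fun i => p (c i) ord0 ord0) => i l.
by have := hp ord0 (c i) l; rewrite cE !ffunE.
Qed.

Definition mixture (R : realType) (m n : nat) (r : 'I_n -> nat)
    (alpha : 'I_n -> R) (T : forall j, type_space R m 'I_(r j))
    (gamma : 'rV[R]_m) : type_space R m (profile r) :=
  fun i => (\sum_j alpha j *: T j (i j)) + gamma.

Definition AM (R : realType) (m n : nat) (r : 'I_n -> nat)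
    (T : forall j, type_space R m 'I_(r j)) : set {ffun profile r -> 'I_m} :=
  [set g | exists (alpha : 'I_n -> R) (gamma : 'rV[R]_m),
     (forall j, 0 < alpha j) /\ IC1 (mixture alpha T gamma) g].

(* Main.v *)
Require Import Defs.
From mathcomp Require Import all_boot all_order all_algebra.
From mathcomp Require Import classical_sets reals.
From mathcomp Require Import lra.

(** All three parts are witnessed by the same type spaces: two outcomes, two
    types per player, player 1 preferring outcome 0 at type 1 and indifferent at
    type 0, and every other player indifferent at both types.

    With two outcomes and two types, a type space [S] matters only through its
    [spread], the increase from type 0 to type 1 of the utility margin of
    outcome 0 over outcome 1: its sign is read off from which of the two
    bijections from types to outcomes are IC ([IC1_identity],
    [IC1_reversal]).  Thus [IC1 (S 1) = IC1 (T 1)] forces the spread of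
    player 1 to be positive, and [IC S = IC T] moreover forces the spread of
    every other player to vanish ([IC_one_player] embeds one-player rules).

    Indifferent players impose no incentive constraint, so every rule that
    ignores player 1 is IC for [T] ([IC_ignore_or_indifferent]).  An affine
    maximizer, in contrast, is a weighted threshold rule: identifying a profile
    with the coalition of players of type 1, outcome 0 goes to coalitions of
    weight at least that of the coalitions with outcome 1, where player [j]
    weighs [alpha j * spread (S j)] ([AM_threshold]).  Player 1 has positive
    weight [w1] even though the rule ignores it, and adding player 1 to a
    coalition does not change the outcome; this yields strict inequalities
    between the weights of the other players.
    - Part (i): if the rule is the parity of the types of players 2 and 3, the
      coalitions [{}], [{1,2}] give [w1 + w2 <= 0] and [{2,3}], [{1,3}] give
      [w1 <= w2], whence [w1 <= 0].
    - Part (ii): if player 2 dictates, [w1 + w2 <= 0], so player 2 has negative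
      spread, but [IC S = IC T] makes that spread zero.
    - Part (iii): if [g] lets player 2 dictate and [h] is the opposite rule, the
      spread of player 2 would be both negative and positive.  The weights
      [alpha] for [g] and [h] may differ, but they do not affect signs. *)

Set Implicit Arguments.
Unset Strict Implicit.
Unset Printing Implicit Defensive.

Import Order.TTheory GRing.Theory Num.Theory.
Local Open Scope ring_scope.
Local Open Scope classical_set_scope.

(** * One player, two outcomes *)

Lemma ord2P (x : 'I_2) : x = ord0 \/ x = ord_max.
Proof. by case: x => [[|[|//]]] ?; [left|right]; apply: val_inj. Qed.

Definition margin (R : realType) (I : finType) (T : type_space R 2 I) (i : I) :
  R := T i ord0 ord0 - T i ord0 ord_max.

Definition spread (R : realType) (T : type_space R 2 'I_2) : R :=
  margin T ord_max - margin T ord0.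

(** Adding the two incentive constraints between [i] and [l] cancels the
    payments. *)
Lemma IC1_margin_le (R : realType) (I : finType) (T : type_space R 2 I)
    (g : {ffun I -> 'I_2}) (i l : I) :
  IC1 T g -> g i = ord0 -> g l = ord_max -> margin T l <= margin T i.
Proof.
move=> [p hp] gi gl; have := hp i l; have := hp l i.
rewrite gi gl /margin; lra.
Qed.

Lemma IC1_identity (R : realType) (T : type_space R 2 'I_2) :
  IC1 T [ffun x => x] <-> spread T <= 0.
Proof.
split=> [gT|]; first by rewrite subr_le0 (IC1_margin_le gT) ?ffunE.
rewrite /spread /margin => sT.
(* This price for outcome 0 makes type 0 exactly indifferent. *)
exists (fun x => if x == ord0 then margin T ord0 else 0) => i l.
rewrite !ffunE /margin.
by case: (ord2P i) => ->; case: (ord2P l) => -> /=; lra.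
Qed.

Lemma IC1_reversal (R : realType) (T : type_space R 2 'I_2) :
  IC1 T [ffun x => rev_ord x] <-> 0 <= spread T.
Proof.
have rev0 : rev_ord ord0 = ord_max :> 'I_2 by apply: val_inj.
have rev1 : rev_ord ord_max = ord0 :> 'I_2 by apply: val_inj.
split=> [gT|]; first by rewrite subr_ge0 (IC1_margin_le gT) ?ffunE.
rewrite /spread /margin => sT.
exists (fun x => if x == ord0 then 0 else margin T ord0) => i l.
rewrite !ffunE /margin.
by case: (ord2P i) => ->; case: (ord2P l) => ->; rewrite ?rev0 ?rev1 /=; lra.
Qed.

(** * Rules that only some players influence *)

Lemma IC_ignore_or_indifferent (R : realType) (m n : nat) (r : 'I_n -> nat)
    (T : forall j, type_space R m 'I_(r j)) (g : {ffun profile r -> 'I_m}) :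
  (forall j, (forall x, T j x = 0) \/
             (forall (i : profile r) (l : 'I_(r j)), g (deviate i l) = g i)) ->
  IC T g.
Proof.
move=> hT; exists (fun=> 0) => j i l.
by case: (hT j) => [T0|->//]; rewrite T0 !mxE.
Qed.

(** The base profile [i0] only serves to fix the types of the other players
    when restricting payments to player [j]. *)
Lemma IC_one_player (R : realType) (m n : nat) (r : 'I_n -> nat)
    (T : forall j, type_space R m 'I_(r j)) (j : 'I_n)
    (f : {ffun 'I_(r j) -> 'I_m}) (i0 : profile r) :
  IC T [ffun i : profile r => f (i j)] <-> IC1 (T j) f.
Proof.
split=> [[p hp]|[p hp]].
  pose c x := deviate i0 (j := j) x.
  have cE x l : deviate (c x) (j := j) l = c l.
    apply/ffunP => k; rewrite !ffunE; case: (eqVneq j k) => [<-|jk].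
      by rewrite !dfwith_in.
    by rewrite !dfwith_out // ffunE dfwith_out.
  exists (fun x => p (c x) ord0 j) => x l.
  by have := hp j (c x) l; rewrite cE !ffunE !dfwith_in.
exists (fun i => const_mx (p (i j))) => k i l; rewrite !mxE !ffunE.
case: (eqVneq k j) => [kj|kj].
  by case: j / kj f p hp => f p hp; rewrite dfwith_in.
by rewrite dfwith_out.
Qed.

(** * Affine maximizers as threshold rules *)

Section BinaryTypes.

Variables (R : realType) (n : nat).

Notation types2 := (fun _ : 'I_n => 2%N).

Definition coalition (A : {set 'I_n}) : profile types2 :=
  [ffun j => if j \in A then ord_max else ord0].

(** Margins are linear in the type space, so a mixture adds up, over the
    members of the coalition, the change caused by a switch to type 1. *)
Lemma mixture_margin (alpha : 'I_n -> R)
    (S : forall j : 'I_n, type_space R 2 'I_2) (gamma : 'rV[R]_2)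
    (A : {set 'I_n}) :
  margin (mixture (r := types2) alpha S gamma) (coalition A) =
  margin (mixture (r := types2) alpha S gamma) (coalition finset.set0)
  + \sum_(j in A) alpha j * spread (S j).
Proof.
have mE B : margin (mixture (r := types2) alpha S gamma) (coalition B) =
    \sum_j alpha j * margin (S j) (coalition B j)
    + (gamma ord0 ord0 - gamma ord0 ord_max).
  rewrite /margin /mixture !mxE !summxE opprD addrACA -sumrB.
  by congr (_ + _); apply: eq_bigr => j _; rewrite !mxE mulrBr.
rewrite !mE [RHS]addrAC [\sum_(j in A) _]big_mkcond -big_split /=; congr (_ + _).
apply: eq_bigr => j _; rewrite !ffunE inE /=.
by case: ifP => _; rewrite ?addr0 // -mulrDr /spread subrKC.
Qed.

Lemma AM_threshold (S : forall j : 'I_n, type_space R 2 'I_2)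
    (g : {ffun profile types2 -> 'I_2}) :
  AM (r := types2) S g ->
  exists alpha : 'I_n -> R, (forall j, 0 < alpha j) /\
    forall A B : {set 'I_n},
      g (coalition A) = ord0 -> g (coalition B) = ord_max ->
      \sum_(j in B) alpha j * spread (S j)
        <= \sum_(j in A) alpha j * spread (S j).
Proof.
move=> [alpha [gamma [alpha_gt0 gS]]]; exists alpha; split=> // A B gA gB.
have := IC1_margin_le gS gA gB.
by rewrite (mixture_margin _ _ _ A) (mixture_margin _ _ _ B) lerD2l.
Qed.

(** * The common type spaces and the witnessing rules *)

Definition lone_player (a j : 'I_n) : type_space R 2 'I_2 :=
  fun x => \row_k ((j == a) && (x == ord_max) && (k == ord0))%:R.

Lemma spread_lone_player (a : 'I_n) : spread (lone_player a a) = 1.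
Proof. rewrite /spread /margin !mxE eqxx /=; lra. Qed.

Lemma IC_lone_player (a : 'I_n) (g : {ffun profile types2 -> 'I_2}) :
  (forall (i : profile types2) (l : 'I_2), g (deviate (j := a) i l) = g i) ->
  IC (r := types2) (lone_player a) g.
Proof.
move=> ga; apply: IC_ignore_or_indifferent => j.
case: (eqVneq j a) => [->|ja]; [by right|left=> x].
by apply/rowP => k; rewrite !mxE (negPf ja).
Qed.

(** The identity rule is not IC for the lone player, so it cannot be IC for a
    type space with the same IC set. *)
Lemma spread_gt0 (a : 'I_n) (S : type_space R 2 'I_2) :
  IC1 S = IC1 (lone_player a a) -> 0 < spread S.
Proof.
move=> ST; rewrite ltNge; apply/negP => /IC1_identity.
by rewrite ST => /IC1_identity; rewrite spread_lone_player ler10.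
Qed.

Definition dictator (b : 'I_n) : {ffun profile types2 -> 'I_2} :=
  [ffun i : profile types2 => [ffun x : 'I_2 => x] (i b)].

Definition antidictator (b : 'I_n) : {ffun profile types2 -> 'I_2} :=
  [ffun i : profile types2 => [ffun x : 'I_2 => rev_ord x] (i b)].

Definition parity (b c : 'I_n) : {ffun profile types2 -> 'I_2} :=
  [ffun i : profile types2 => if i b == i c then ord0 else ord_max].

Lemma IC_dictator (a b : 'I_n) :
  a != b -> IC (r := types2) (lone_player a) (dictator b).
Proof.
by move=> ab; apply: IC_lone_player => i l; rewrite !ffunE dfwith_out.
Qed.

Lemma IC_antidictator (a b : 'I_n) :
  a != b -> IC (r := types2) (lone_player a) (antidictator b).
Proof.
by move=> ab; apply: IC_lone_player => i l; rewrite !ffunE dfwith_out.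
Qed.

Lemma IC_parity (a b c : 'I_n) : a != b -> a != c ->
  IC (r := types2) (lone_player a) (parity b c).
Proof.
by move=> ab ac; apply: IC_lone_player => i l; rewrite !ffunE !dfwith_out.
Qed.

(** * Weights forced by the witnessing rules *)

Lemma sum_pair (a b : 'I_n) (F : 'I_n -> R) :
  a != b -> \sum_(j in [set a; b]%SET) F j = F a + F b.
Proof. by move=> ab; rewrite big_setU1 ?inE // big_set1. Qed.

(** Compare the empty coalition with [{a, b}]. *)
Lemma AM_dictator_spread (S : forall j : 'I_n, type_space R 2 'I_2)
    (a b : 'I_n) :
  a != b -> 0 < spread (S a) -> AM (r := types2) S (dictator b) ->
  spread (S b) < 0.
Proof.
move=> ab sa /AM_threshold[alpha [alpha_gt0 thr]].
have := thr finset.set0 [set a; b]%SET.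
rewrite !ffunE !inE eqxx orbT big_set0 sum_pair // => /(_ erefl erefl) w_le0.
rewrite -(pmulr_rlt0 _ (alpha_gt0 b)).
by have := mulr_gt0 (alpha_gt0 a) sa; lra.
Qed.

(** Compare [{b}] with [{a}]. *)
Lemma AM_antidictator_spread (S : forall j : 'I_n, type_space R 2 'I_2)
    (a b : 'I_n) :
  a != b -> 0 < spread (S a) -> AM (r := types2) S (antidictator b) ->
  0 < spread (S b).
Proof.
move=> ab sa /AM_threshold[alpha [alpha_gt0 thr]].
rewrite -(pmulr_rgt0 _ (alpha_gt0 b)).
apply: lt_le_trans (mulr_gt0 (alpha_gt0 a) sa) _.
have := thr [set b]%SET [set a]%SET; rewrite !big_set1; apply.
  by rewrite !ffunE !inE eqxx; apply: val_inj.
by rewrite !ffunE !inE eq_sym (negPf ab); apply: val_inj.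
Qed.

(** Compare the empty coalition with [{a, b}], and [{b, c}] with [{a, c}]: the
    contributions of [b] and [c] cancel in the sum of both inequalities. *)
Lemma AM_parity_spread (S : forall j : 'I_n, type_space R 2 'I_2)
    (a b c : 'I_n) :
  a != b -> a != c -> b != c -> AM (r := types2) S (parity b c) ->
  spread (S a) <= 0.
Proof.
move=> ab ac bc /AM_threshold[alpha [alpha_gt0 thr]].
have ba : (b == a) = false by rewrite eq_sym (negPf ab).
have ca : (c == a) = false by rewrite eq_sym (negPf ac).
have cb : (c == b) = false by rewrite eq_sym (negPf bc).
have := thr finset.set0 [set a; b]%SET; have := thr [set b; c]%SET [set a; c]%SET.
rewrite !ffunE !inE !eqxx ba ca cb (negPf bc) /= big_set0 !sum_pair //.
move=> /(_ erefl erefl) h1 /(_ erefl erefl) h2.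
by rewrite -(pmulr_rle0 _ (alpha_gt0 a)); lra.
Qed.

End BinaryTypes.

Theorem theorem1p2 (R : realType) :
  (forall (n : nat) (hn : (3 <= n)%N),
     let player1 : 'I_n := Ordinal (ltnW (ltnW hn)) in
     exists (m : nat) (r : 'I_n -> nat) (T : forall j, type_space R m 'I_(r j))
            (g : {ffun profile r -> 'I_m}),
       [/\ (1 <= m)%N, IC T g &
         ~ exists S : forall j, type_space R m 'I_(r j),
             AM S g /\ IC1 (S player1) = IC1 (T player1)])
  /\
  (forall (n : nat) (hn : (2 <= n)%N),
     exists (m : nat) (r : 'I_n -> nat) (T : forall j, type_space R m 'I_(r j))
            (g : {ffun profile r -> 'I_m}),
       [/\ (1 <= m)%N, IC T g &
         ~ exists S : forall j, type_space R m 'I_(r j),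
             AM S g /\ IC S = IC T])
  /\
  (forall (n : nat) (hn : (2 <= n)%N),
     let player1 : 'I_n := Ordinal (ltnW hn) in
     exists (m : nat) (r : 'I_n -> nat) (T : forall j, type_space R m 'I_(r j))
            (g h : {ffun profile r -> 'I_m}),
       [/\ (1 <= m)%N, IC T g, IC T h &
         ~ exists S : forall j, type_space R m 'I_(r j),
             [/\ AM S g, AM S h & IC1 (S player1) = IC1 (T player1)]]).
Proof.
split; [|split] => n hn.
- move=> a; pose b : 'I_n := Ordinal (ltnW hn); pose c : 'I_n := Ordinal hn.
  exists 2%N, (fun=> 2%N), (lone_player R a), (parity b c).
  split=> //; first exact: IC_parity.
  move=> [S [gS /spread_gt0]]; apply/negP; rewrite -leNgt.
  exact: (@AM_parity_spread _ _ S a b c).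
- pose a : 'I_n := Ordinal (ltnW hn); pose b : 'I_n := Ordinal hn.
  have ab : a != b by [].
  exists 2%N, (fun=> 2%N), (lone_player R a), (dictator b).
  split=> //; first exact: IC_dictator.
  move=> [S [gS ST]]; pose i0 := coalition (@finset.set0 'I_n).
  have sa : 0 < spread (S a).
    rewrite ltNge; apply/negP => /IC1_identity/(IC_one_player S _ i0).
    rewrite ST => /(IC_one_player (lone_player R a) _ i0)/IC1_identity.
    by rewrite spread_lone_player ler10.
  have : 0 <= spread (S b).
    apply/IC1_reversal/(IC_one_player S _ i0).
    by rewrite ST; apply: IC_antidictator.
  by rewrite leNgt (AM_dictator_spread ab sa gS).
- move=> a; pose b : 'I_n := Ordinal hn; have ab : a != b by [].
  exists 2%N, (fun=> 2%N), (lone_player R a), (dictator b), (antidictator b).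
  split=> //; [exact: IC_dictator|exact: IC_antidictator|].
  move=> [S [gS hS /spread_gt0 sa]].
  have := lt_trans (AM_antidictator_spread ab sa hS)
                   (AM_dictator_spread ab sa gS).
  by rewrite ltxx.
Qed.
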